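(* Let \(G\) be a minimal counterexample to the Erd\H{o}s--Gy\'arf\'as conjecture (as defined in the context), and let \(V_3=\{v\in V(G): d(v)=3\}\). Then \(|V_3|\geq \frac{4}{7}|V(G)|\).
   Context: All graphs are finite, simple and undirected; \(d(v)\) denotes the degree of a vertex \(v\) and \(\delta(G)\) the minimum degree of \(G\). A minimal counterexample to the Erd\H{o}s--Gy\'arf\'as conjecture is a graph \(G\) with \(\delta(G)\geq 3\) that contains no cycle whose length is a power of \(2\), chosen so that its number of vertices is minimum among all such graphs and, subject to that, its number of edges is minimum. *)

(* Defs.v *)
From mathcomp Require Import all_boot.

Set Implicit Arguments.
Unset Strict Implicit.
Unset Printing Implicit Defensive.

Record sgraph := SGraph {
  vertex :> finType;
  adj : rel vertex;
  adj_sym : symmetric adj;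
  adj_irrefl : irreflexive adj
}.

Definition neighbours (G : sgraph) (v : G) : {set G} := [set w | adj v w].

Definition degree (G : sgraph) (v : G) : nat := #|neighbours v|.

(* Every degree is less than #|G|, so starting the minimum at #|G| has no
   effect when G has a vertex. The graph with no vertices gets minimum
   degree 0, so a lower bound 0 < min_degree G forces G to be nonempty. *)
Definition min_degree (G : sgraph) : nat := \big[minn/#|G|]_(v : G) degree v.

Definition edges (G : sgraph) : {set {set G}} :=
  [set [set x; y] | x : G, y : G in neighbours x].

(* [ucycle] alone accepts [::] and, since adj is symmetric, [:: x; y] for every
   edge xy; a cycle of a simple graph has at least three vertices. Its length,
   i.e. its number of edges, is size c. *)
Definition is_cycle (G : sgraph) (c : seq G) : Prop :=
  ucycle (@adj G) c /\ 3 <= size c.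

Definition has_pow2_cycle (G : sgraph) : Prop :=
  exists (c : seq G) (k : nat), is_cycle c /\ size c = 2 ^ k.

Definition eg_counterexample (G : sgraph) : Prop :=
  3 <= min_degree G /\ ~ has_pow2_cycle G.

Definition minimal_eg_counterexample (G : sgraph) : Prop :=
  [/\ eg_counterexample G,
      forall H : sgraph, eg_counterexample H -> #|G| <= #|H|
    & forall H : sgraph, eg_counterexample H -> #|H| = #|G| ->
        #|edges G| <= #|edges H|].

Definition V3 (G : sgraph) : {set G} := [set v | degree v == 3].

(* Main.v *)
Require Import Defs.
From mathcomp Require Import all_boot all_order all_algebra.

(** Deleting an edge between two vertices of degree at least 4 would leave a
    smaller counterexample, so these vertices form an independent set [S]: every
    edge leaving [S] ends in [V3 G].  Counting the edges between [S] and [V3 G]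
    from both sides gives [4 |S| <= 3 |V3 G|]. *)

Lemma leq_bigmin (I : Type) (r : seq I) (F : I -> nat) (m n : nat) :
  (m <= \big[minn/n]_(i <- r) F i) = (m <= n) && all (fun i => m <= F i) r.
Proof.
elim: r => [|i r IHr]; first by rewrite big_nil andbT.
by rewrite big_cons leq_min IHr /= andbCA.
Qed.

(** The conjunct [m <= #|G|] comes from the start value of the minimum; it decides the case of a
    graph without vertices. *)
Lemma leq_min_degreeP (G : sgraph) (m : nat) :
  reflect (m <= #|G| /\ forall v : G, m <= degree v) (m <= min_degree G).
Proof.
rewrite leq_bigmin; apply: (iffP andP) => -[mG mdeg]; split=> //.
  by move=> v; apply: (allP mdeg); rewrite mem_index_enum.
by apply/allP => v _; apply: mdeg.
Qed.

Section DeleteEdge.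

Variables (G : sgraph) (u v : G).

Definition del_adj : rel G :=
  fun x y => adj x y && ([set x; y] != [set u; v]).

Lemma del_adj_sym : symmetric del_adj.
Proof. by move=> x y; rewrite /del_adj adj_sym setUC. Qed.

Lemma del_adj_irrefl : irreflexive del_adj.
Proof. by move=> x; rewrite /del_adj adj_irrefl. Qed.

Definition del_edge : sgraph := SGraph del_adj_sym del_adj_irrefl.

(** Only an endpoint can lose a neighbour, and it loses at most one. The loss is added on the right,
    as a boolean, to avoid truncated subtraction. *)
Lemma degree_del_edge (x : G) :
  degree x <= (x \in [set u; v]) + degree (x : del_edge).
Proof.
have [xuv|xNuv] := boolP (x \in [set u; v]); last first.
  apply/subset_leq_card/subsetP => w; rewrite !inE /= /del_adj => ->/=.
  by apply: contraNneq xNuv => <-; rewrite set21.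
(* [z] is the other endpoint, the only neighbour that [x] can lose. *)
pose z := if x == u then v else u.
have sub : neighbours x \subset z |: neighbours (x : del_edge).
  apply/subsetP => /= w; rewrite !inE /= /del_adj => -> /=.
  case: eqVneq => //= wz; apply: contraNneq wz => xw_uv.
  (* The equality of unordered pairs is used through these memberships, which also cover [u = v]. *)
  have w_uv : w \in [set u; v] by rewrite -xw_uv set22.
  have [u_xw v_xw] : u \in [set x; w] /\ v \in [set x; w].
    by rewrite xw_uv set21 set22.
  move: w_uv u_xw v_xw; rewrite /z !inE; have [->|_] := eqVneq x u.
    by case/orP=> [/eqP->|//] _; rewrite orbb eq_sym.
  by move=> _ /eqP->.
apply: leq_trans (subset_leq_card sub) _.
by rewrite cardsU1 leq_add2r leq_b1.
Qed.

Lemma edges_del_edge : adj u v -> #|edges del_edge| < #|edges G|.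
Proof.
move=> uv; apply/proper_card/properP; split.
  apply/subsetP => _ /imset2P[x y _ + ->]; rewrite inE => /andP[xy _].
  by apply: imset2_f; rewrite inE.
exists [set u; v]; first by apply: imset2_f; rewrite inE.
by apply/imset2P => -[x y _ + e]; rewrite inE /= /del_adj -e eqxx andbF.
Qed.

Lemma has_pow2_cycle_del_edge : has_pow2_cycle del_edge -> has_pow2_cycle G.
Proof.
case=> c [k [[/andP[cyc unq] size_c] ck]]; exists c, k.
split=> //; split=> //; rewrite /ucycle unq andbT.
by apply: sub_cycle cyc => x y /andP[].
Qed.

End DeleteEdge.

Lemma minimal_high_degree_nonadj (G : sgraph) (u v : G) :
  minimal_eg_counterexample G -> 3 < degree u -> 3 < degree v -> ~~ adj u v.
Proof.
case=> -[/leq_min_degreeP[G3 deg3] Gcyc] _ min_edges u4 v4.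
apply/negP => uv; have := edges_del_edge _ _ _ uv.
(* [del_edge] keeps the vertex set, so the clause of minimality that it would violate is the one on
   edges. *)
rewrite ltnNge => /negP; apply; apply: min_edges => //; split.
  apply/leq_min_degreeP; split=> // x.
  have := degree_del_edge _ u v x; rewrite !inE.
  case: (eqVneq x u) => [->|_] /=; first exact: leq_trans u4.
  case: (eqVneq x v) => [->|_] /=; first exact: leq_trans v4.
  exact: leq_trans (deg3 x).
by move/has_pow2_cycle_del_edge.
Qed.

Lemma minimal_high_degree_count (G : sgraph) :
  minimal_eg_counterexample G -> 4 * #|~: V3 G| <= 3 * #|V3 G|.
Proof.
move=> minG; have [[/leq_min_degreeP[_ deg3] _] _ _] := minG.
have deg4 (x : G) : x \in ~: V3 G -> 3 < degree x.
  by rewrite !inE ltn_neqAle eq_sym deg3 andbT.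
(* Degrees become row sums of the adjacency matrix, so that double counting is an exchange of
   sums. *)
have degE (x : G) : degree x = \sum_(y : G) adj x y.
  by rewrite /degree -sum1_card big_mkcond; apply: eq_bigr => y _; rewrite inE; case: adj.
have outV3 (x : G) : x \in ~: V3 G -> degree x = \sum_(y in V3 G) adj x y.
  move=> xS; rewrite degE [RHS]big_mkcond; apply: eq_bigr => y _.
  case: ifPn => // yV3; apply/eqP; rewrite eqb0.
  by apply: minimal_high_degree_nonadj; rewrite ?deg4 // in_setC.
rewrite mulnC -sum_nat_const mulnC -sum_nat_const.
apply: (@leq_trans (\sum_(x in ~: V3 G) \sum_(y in V3 G) adj x y)).
  by apply: leq_sum => x xS; rewrite -outV3 // deg4.
(* Here 3 is rewritten as [degree y], which bounds the number of edges from [y] to the complement of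
   [V3 G]. *)
rewrite exchange_big; apply: leq_sum => y; rewrite inE => /eqP <- /=.
rewrite degE big_mkcond; apply: leq_sum => x _.
by rewrite adj_sym; case: ifP.
Qed.

Theorem theorem0p1 (G : sgraph) (hG : minimal_eg_counterexample G) :
  ((4%:R / 7%:R) * #|G|%:R <= #|V3 G|%:R :> rat)%R.
Proof.
rewrite GRing.mulrAC Num.Theory.ler_pdivrMr // -!GRing.natrM Num.Theory.ler_nat.
(* Splitting [#|G|] over [V3 G] and its complement, and 7 as [4 + 3], lets [4 * #|V3 G|] cancel. *)
rewrite -(cardsC (V3 G)) mulnDr [leqRHS]mulnC -[7]/(4 + 3) mulnDl leq_add2l.
exact: minimal_high_degree_count.
Qed.
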